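(* Let $V\subseteq\mathcal V$ be finite and $\mathcal E,\mathcal F\in\mathit{DProg}(V)$. Then: (1) $\mathcal E\le_P^p\mathcal F$ if and only if $\mathrm{span}(\mathcal F)\subseteq\mathrm{span}(\mathcal E)$; (2) $\mathcal E\le_T^p\mathcal F$ if and only if $T_{\mathcal E}\sqsubseteq T_{\mathcal F}$ and $\mathrm{span}(\mathcal F\circ\mathcal P_{T_{\mathcal E}})\subseteq\mathrm{span}(\mathcal E\circ\mathcal P_{T_{\mathcal E}})$; (3) if both $\mathcal E$ and $\mathcal F$ are trace-preserving, then $\mathcal E\le_T^p\mathcal F$ iff $\mathcal E\le_P^p\mathcal F$.
   Context: $\mathcal V$ is a countably infinite set of quantum variables, each with state space $\mathbb C^2$; for finite $V\subseteq\mathcal V$, $\mathcal H_V=\bigotimes_{q\in V}\mathcal H_q$ with identity $I_V$. $\mathcal D(\mathcal H)$ denotes partial density operators (positive, trace $\le1$), $\mathcal S(\mathcal H)$ the projectors on $\mathcal H$, $\sqsubseteq$ the Löwner order; projectors are identified with their images (subspaces), so $P\sqsubseteq Q$ means subspace inclusion. $\mathit{DProg}(V)$ is the set of completely positive trace-nonincreasing super-operators on $\mathcal L(\mathcal H_V)$. Operators/super-operators on subsystems are implicitly extended to larger systems by tensoring with identities. For finite $W$ and $P,Q\in\mathcal S(\mathcal H_W)$: $\mathcal E\models_{tot}(P,Q)$ iff for every finite $X\supseteq V\cup W$ and $\rho\in\mathcal D(\mathcal H_X)$, ${\rm tr}(P\rho)\le{\rm tr}(Q\mathcal E(\rho))$;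 $\mathcal E\models_{par}(P,Q)$ iff for all such $X,\rho$, ${\rm tr}(P\rho)\le{\rm tr}(Q\mathcal E(\rho))+{\rm tr}(\rho)-{\rm tr}(\mathcal E(\rho))$. $\mathcal E\le_T^p\mathcal F$ iff for every finite $W$ and all $P,Q\in\mathcal S(\mathcal H_W)$, $\mathcal E\models_{tot}(P,Q)$ implies $\mathcal F\models_{tot}(P,Q)$; $\le_P^p$ likewise with $\models_{par}$. For a completely positive super-operator $\mathcal G$ with Kraus operators $\{G_i\}$ (i.e. $\mathcal G(A)=\sum_iG_iAG_i^\dagger$), $\mathrm{span}(\mathcal G)$ is the linear span of $\{G_i\}$ in $\mathcal L(\mathcal H_V)$ (independent of the Kraus representation). The termination space is $T_{\mathcal E}=\{|\psi\rangle\in\mathcal H_V:{\rm tr}(\mathcal E(|\psi\rangle\langle\psi|))={\rm tr}(|\psi\rangle\langle\psi|)\}$, a subspace identified with its projector, and $\mathcal P_{T_{\mathcal E}}$ is the super-operator $\rho\mapsto T_{\mathcal E}\rho T_{\mathcal E}$. *)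

(* Defs.v *)
From HB Require Import structures.
From mathcomp Require Import all_boot all_order all_algebra finmap.
From mathcomp Require Import complex reals.
Set Implicit Arguments. Unset Strict Implicit. Unset Printing Implicit Defensive.
Import Order.TTheory GRing.Theory Num.Theory.
Local Open Scope ring_scope.

(* Quantum variables are natural numbers; each has state space C^2.
   A finite set of variables is X : {fset nat}.  The computational basis of
   H_X is indexed by assignments X -> bool. *)
Definition bidx (X : {fset nat}) := {ffun X -> bool}.
Definition dim (X : {fset nat}) : nat := #|{: bidx X}|.

Section Quantum.
Variable C : numClosedFieldType.

Definition op (X : {fset nat}) := 'M[C]_(dim X).
Definition vec (X : {fset nat}) := 'cV[C]_(dim X).

Definition bv (X : {fset nat}) (i : 'I_(dim X)) : bidx X := enum_val i.

Definition adj m n (A : 'M[C]_(m, n)) : 'M[C]_(n, m) := (map_mx Num.conj A)^T.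

Definition psd n (A : 'M[C]_n) : Prop :=
  forall v : 'cV[C]_n, 0 <= (adj v *m A *m v) 0 0.
Definition lowner n (A B : 'M[C]_n) : Prop := psd (B - A).
Definition pdo n (rho : 'M[C]_n) : Prop := psd rho /\ \tr rho <= 1.
Definition is_proj n (P : 'M[C]_n) : Prop := P *m P = P /\ adj P = P.

(* Restriction of a basis assignment on X to W (W is meant to be a subset of X). *)
Definition restr (W X : {fset nat}) (s : bidx X) : bidx W :=
  [ffun w : W => if @insub nat (fun x => x \in X) X (val w) is Some x then s x else false].

Definition agree_out (W X : {fset nat}) (s t : bidx X) : bool :=
  [forall x : X, (val x \notin W) ==> (s x == t x)].

(* Extension A ⊗ I_{X \ W} of an operator A on H_W to H_X (for W ⊆ X). *)
Definition ext (W X : {fset nat}) (A : op W) : op X :=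
  \matrix_(i, j) (A (enum_rank (restr W (bv i))) (enum_rank (restr W (bv j)))
                  * (agree_out W (bv i) (bv j))%:R).


(* A completely positive super-operator on L(H_V), given by a list of Kraus
   operators: E(A) = \sum_i E_i A E_i^dagger. *)
Definition superop (V : {fset nat}) := seq (op V).

Definition so_apply V (E : superop V) (rho : op V) : op V :=
  \sum_(K <- E) K *m rho *m adj K.

(* Its cylindric extension E ⊗ id to L(H_X), X ⊇ V: Kraus operators E_i ⊗ I. *)
Definition so_ext V (X : {fset nat}) (E : superop V) (rho : op X) : op X :=
  \sum_(K <- E) @ext V X K *m rho *m adj (@ext V X K).


Definition so_comp V (G H : superop V) : superop V :=
  [seq K *m L | K <- G, L <- H].

(* P_T : rho |-> T rho T *)
Definition so_proj V (T : op V) : superop V := [:: T].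

Definition so_span V (G : superop V) : {vspace 'M[C]_(dim V)} := <<G>>%VS.

(* DProg(V): completely positive (Kraus form) and trace-nonincreasing *)
Definition DProg V (E : superop V) : Prop :=
  forall rho : op V, pdo rho -> \tr (so_apply E rho) <= \tr rho.

Definition trace_preserving V (E : superop V) : Prop :=
  forall rho : op V, \tr (so_apply E rho) = \tr rho.

Definition models_tot V (E : superop V) (W : {fset nat}) (P Q : op W) : Prop :=
  forall X : {fset nat}, (V `|` W `<=` X)%fset ->
  forall rho : op X, pdo rho ->
    \tr (@ext W X P *m rho) <= \tr (@ext W X Q *m @so_ext V X E rho).

Definition models_par V (E : superop V) (W : {fset nat}) (P Q : op W) : Prop :=
  forall X : {fset nat}, (V `|` W `<=` X)%fset ->
  forall rho : op X, pdo rho ->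
    \tr (@ext W X P *m rho) <=
      \tr (@ext W X Q *m @so_ext V X E rho) + \tr rho - \tr (@so_ext V X E rho).

Definition le_T V (E F : superop V) : Prop :=
  forall (W : {fset nat}) (P Q : op W), is_proj P -> is_proj Q ->
    models_tot E P Q -> models_tot F P Q.

Definition le_P V (E F : superop V) : Prop :=
  forall (W : {fset nat}) (P Q : op W), is_proj P -> is_proj Q ->
    models_par E P Q -> models_par F P Q.

Definition in_term V (E : superop V) (psi : vec V) : Prop :=
  \tr (so_apply E (psi *m adj psi)) = \tr (psi *m adj psi).

(* T is the projector onto the termination space of E
   (the range of a projector T is {psi | T psi = psi}) *)
Definition term_proj V (E : superop V) (T : op V) : Prop :=
  is_proj T /\ forall psi : vec V, T *m psi = psi <-> in_term E psi.

End Quantum.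
Arguments ext {C} W X A.
Arguments so_ext {C V} X E rho.
Arguments restr W {X} s.
Arguments agree_out W {X} s t.

(* Main.v *)
Require Import Defs.
From HB Require Import structures.
From mathcomp Require Import all_boot all_order all_algebra finmap.
From mathcomp Require Import spectral.
From mathcomp Require Import complex reals.
Set Implicit Arguments. Unset Strict Implicit. Unset Printing Implicit Defensive.
Import Order.TTheory GRing.Theory Num.Theory.
Local Open Scope ring_scope.

(** For projectors, correctness is a kernel condition.  Let [S = 1 - sum K^* K]
    be the (positive) trace defect of a program with Kraus operators [K].  In
    the Heisenberg picture, partial correctness of [(P, Q)] on a system [X] says
    [P <= 1 - Z] with [Z = sum K^* (1 - Q) K], and total correctness says the
    same with [S + Z] in place of [Z].  As [P] is a projector and
    [0 <= Z <= 1], this holds iff [Z P = 0]: so partial correctness means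
    [(1 - Q) K P = 0] for all [K], a condition linear in [K], and total
    correctness means in addition that the range of [P] lies in
    [ker S = T_E] (tensored with the rest of the system).  This gives the
    implications from spans to refinement.  Conversely, test with [P] the
    projector onto the Choi vector [(T (x) I) Omega] and [Q] the projector onto
    the span of the [(K T (x) I) Omega], where [Omega] is a maximally entangled
    vector between [V] and a disjoint copy of it, [T = 1] in the partial case
    and [T = T_E] in the total case. *)

(** * Adjoints, positive operators and orthogonal projectors *)

Section Positivity.
Variable C : numClosedFieldType.

Lemma adjE m n (A : 'M[C]_(m, n)) i j : adj A i j = (A j i)^*.
Proof. by rewrite !mxE. Qed.

Lemma adjK m n (A : 'M[C]_(m, n)) : adj (adj A) = A.
Proof. by apply/matrixP=> i j; rewrite !adjE conjCK. Qed.

Lemma adjM m n p (A : 'M[C]_(m, n)) (B : 'M[C]_(n, p)) :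
  adj (A *m B) = adj B *m adj A.
Proof. by rewrite /adj map_mxM trmx_mul. Qed.

Lemma adjD m n (A B : 'M[C]_(m, n)) : adj (A + B) = adj A + adj B.
Proof. by rewrite /adj map_mxD linearD. Qed.

Lemma adjB m n (A B : 'M[C]_(m, n)) : adj (A - B) = adj A - adj B.
Proof. by rewrite /adj map_mxB linearB. Qed.

Lemma adjZ m n a (A : 'M[C]_(m, n)) : adj (a *: A) = a^* *: adj A.
Proof. by rewrite /adj map_mxZ linearZ. Qed.

Lemma adj0 m n : adj (0 : 'M[C]_(m, n)) = 0.
Proof. by rewrite /adj map_mx0 trmx0. Qed.

Lemma adj1 n : adj (1%:M : 'M[C]_n) = 1%:M.
Proof. by rewrite /adj map_mx1 trmx1. Qed.

Lemma adj_delta m n i j : adj (delta_mx i j : 'M[C]_(m, n)) = delta_mx j i.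
Proof. by apply/matrixP=> k l; rewrite adjE !mxE conjC_nat andbC. Qed.

Lemma gramE m n (A : 'M[C]_(m, n)) j :
  (adj A *m A) j j = \sum_i `|A i j| ^+ 2.
Proof. by rewrite mxE; apply: eq_bigr => i _; rewrite adjE normCK mulrC. Qed.

Lemma gram_ge0 m (v : 'cV[C]_m) : 0 <= (adj v *m v) 0 0.
Proof. by rewrite gramE sumr_ge0 // => i _; rewrite exprn_ge0. Qed.

Lemma gram_diag_eq0 m n (A : 'M[C]_(m, n)) :
  (forall j, (adj A *m A) j j = 0) -> A = 0.
Proof.
move=> A0; apply/matrixP=> i j; rewrite mxE; apply/eqP.
have /eqP := A0 j; rewrite gramE psumr_eq0; last by move=> *; rewrite exprn_ge0.
by move=> /allP/(_ i); rewrite mem_index_enum sqrf_eq0 normr_eq0; apply.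
Qed.

Lemma gram_eq0 m n (A : 'M[C]_(m, n)) : adj A *m A = 0 -> A = 0.
Proof. by move=> A0; apply: gram_diag_eq0 => j; rewrite A0 mxE. Qed.

Lemma psd_gram m n (B : 'M[C]_(m, n)) : psd (adj B *m B).
Proof. by move=> v; rewrite mulmxA -adjM -mulmxA gram_ge0. Qed.

Lemma mxaddE m n (A B : 'M[C]_(m, n)) i j : (A + B) i j = A i j + B i j.
Proof. by rewrite mxE. Qed.

Lemma mxoppE m n (A : 'M[C]_(m, n)) i j : (- A) i j = - A i j.
Proof. by rewrite mxE. Qed.

Lemma mxscaleE m n a (A : 'M[C]_(m, n)) i j : (a *: A) i j = a * A i j.
Proof. by rewrite mxE. Qed.

(* Polarization; replacing [v] by ['i *: v] separates the two cross terms. *)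
Lemma form_eq0 n (B : 'M[C]_n) :
  (forall v : 'cV_n, (adj v *m B *m v) 0 0 = 0) -> B = 0.
Proof.
move=> B0; pose q (u v : 'cV[C]_n) := (adj u *m B *m v) 0 0.
have qD u v : q u v + q v u = 0.
  have := B0 (u + v); rewrite adjD !mulmxDl !mulmxDr !mxaddE !B0 add0r addr0.
  by rewrite addrC.
have qi u v : q u v - q v u = 0.
  have := qD u ('i *: v); rewrite /q adjZ conjCi.
  rewrite -scalemxAr -!scalemxAl !mxscaleE mulNr -mulrBr => /eqP.
  by rewrite mulf_eq0 (negPf (neq0Ci _)) /= => /eqP.
have q0 u v : q u v = 0.
  have e : q u v = q v u by apply/eqP; rewrite -subr_eq0 qi.
  by have /eqP := qD u v; rewrite -e -mulr2n mulrn_eq0 /= => /eqP.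
apply/matrixP=> i j; rewrite mxE -(q0 (delta_mx i 0) (delta_mx j 0)) /q.
by rewrite adj_delta -rowE -colE !mxE.
Qed.

(** Positivity is stated through the values of the form only. These values are real, so [A] and
    [adj A] have the same form, and polarization applies. *)
Lemma psd_herm n (A : 'M[C]_n) : psd A -> adj A = A.
Proof.
move=> pA; apply/eqP; rewrite -subr_eq0; apply/eqP/form_eq0 => v.
rewrite mulmxBr mulmxBl mxaddE mxoppE.
have -> : adj v *m adj A *m v = adj (adj v *m A *m v) by rewrite !adjM adjK mulmxA.
by rewrite adjE geC0_conj ?subrr.
Qed.

(** Spectral theorem: [B] is the square root of the diagonal of eigenvalues, times the unitary [U].
    Only a Gram factor is needed, not the positive square root of [A]. *)
Lemma psd_factor n (A : 'M[C]_n) : psd A -> exists B : 'M[C]_n, A = adj B *m B.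
Proof.
move=> pA; have tE (M : 'M[C]_n) : map_mx Num.conj M^T = adj M by rewrite -map_trmx.
have nA : A \is normalmx by apply/normalmxP; rewrite tE psd_herm.
have := orthomx_spectralP nA.
have := spectral_unitarymx A.
set U := spectralmx A; set d := spectral_diag A => uU.
rewrite invmx_unitary // tE => AE.
have UU : U *m adj U = 1%:M by rewrite -tE; apply/unitarymxP.
(* The columns of [adj U] are eigenvectors, so each eigenvalue is a value of the form of [A] and is
   nonnegative. *)
pose e i : 'cV[C]_n := adj U *m delta_mx i 0.
have dE i : (adj (e i) *m A *m e i) 0 0 = d 0 i.
  rewrite AE /e adjM adjK !mulmxA -(mulmxA _ U) UU mulmx1 -(mulmxA _ U) UU mulmx1.
  by rewrite adj_delta -rowE -colE !mxE eqxx mulr1n.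
have d0 i : 0 <= d 0 i by rewrite -dE.
exists (diag_mx (map_mx sqrtC d) *m U).
rewrite adjM mulmxA -(mulmxA (adj U)) [in LHS]AE; congr (_ *m _ *m _).
have -> : adj (diag_mx (map_mx sqrtC d)) = diag_mx (map_mx sqrtC d).
  rewrite /adj map_diag_mx tr_diag_mx; congr diag_mx.
  by apply/matrixP=> k l; rewrite !mxE ord1; apply: geC0_conj; rewrite sqrtC_ge0.
rewrite mulmx_diag; congr diag_mx.
by apply/matrixP=> k l; rewrite !mxE ord1 -expr2 sqrtCK.
Qed.

(** With [A = adj S *m S], the trace becomes that of [S *m B *m adj S], whose diagonal entries are
    values of the form of [B]. *)
Lemma psd_tr_mul_ge0 n (A B : 'M[C]_n) : psd A -> psd B -> 0 <= \tr (A *m B).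
Proof.
move=> /psd_factor[S ->] pB; rewrite -mulmxA mxtrace_mulC -mulmxA.
rewrite /mxtrace sumr_ge0 // => i _.
have := pB (adj S *m delta_mx i (0 : 'I_1)); rewrite adjM adjK adj_delta !mulmxA.
by rewrite -colE mxE -!mulmxA -rowE mxE.
Qed.
Lemma psdD n (A B : 'M[C]_n) : psd A -> psd B -> psd (A + B).
Proof. by move=> pA pB v; rewrite mulmxDr mulmxDl mxaddE addr_ge0. Qed.

Lemma psd_sum n (I : eqType) (r : seq I) (A : I -> 'M[C]_n) :
  {in r, forall i, psd (A i)} -> psd (\sum_(i <- r) A i).
Proof.
move=> pA; rewrite big_seq; apply: big_ind => // [v|]; last exact: psdD.
by rewrite mulmx0 mul0mx mxE.
Qed.

Lemma psd_congr m n (A : 'M[C]_n) (B : 'M[C]_(n, m)) :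
  psd A -> psd (adj B *m A *m B).
Proof. by move=> pA v; have := pA (B *m v); rewrite adjM !mulmxA. Qed.

(** With [A = adj S *m S], the hypothesis says that the Gram matrix of [S *m B] vanishes. *)
Lemma psd_kernel n m (A : 'M[C]_n) (B : 'M[C]_(n, m)) :
  psd A -> adj B *m A *m B = 0 -> A *m B = 0.
Proof.
move=> /psd_factor[S ->]; rewrite !mulmxA -adjM -mulmxA => /gram_eq0.
by rewrite -mulmxA => ->; rewrite mulmx0.
Qed.

Lemma psd_outer n (v : 'cV[C]_n) : psd (v *m adj v).
Proof. by rewrite -{1}(adjK v); apply: psd_gram. Qed.

Lemma tr_outer n (A : 'M[C]_n) (v : 'cV[C]_n) :
  \tr (A *m (v *m adj v)) = (adj v *m A *m v) 0 0.
Proof. by rewrite mulmxA mxtrace_mulC mulmxA trace_mx11. Qed.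

(** This passes from inequalities over all states to operator inequalities. The test states are
    normalized rank-one operators; a vector of norm zero is treated apart. *)
Lemma psdP n (A : 'M[C]_n) :
  psd A <-> forall rho, pdo rho -> 0 <= \tr (A *m rho).
Proof.
split=> [pA rho [prho _]|H v]; first exact: psd_tr_mul_ge0.
have [v0|v0] := eqVneq ((adj v *m v) 0 0) 0.
  rewrite (@gram_diag_eq0 _ _ v) ?mulmx0 ?mxE // => j.
  by rewrite ord1.
have c0 : 0 < (adj v *m v) 0 0 by rewrite lt_def v0 gram_ge0.
set c := (adj v *m v) 0 0 in v0 c0.
have /H : pdo (c^-1 *: (v *m adj v)).
  split=> [u|]; last by rewrite mxtraceZ -(mul1mx (v *m _)) tr_outer mulmx1 mulVf.
  rewrite -scalemxAr -scalemxAl mxscaleE mulr_ge0 ?invr_ge0 ?(ltW c0) //.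
  exact: psd_outer.
by rewrite -scalemxAr mxtraceZ tr_outer pmulr_rge0 // invr_gt0.
Qed.

Lemma proj_compl n (P : 'M[C]_n) : is_proj P -> is_proj (1%:M - P).
Proof.
case=> PP aP; split; last by rewrite adjB adj1 aP.
by rewrite mulmxBl mul1mx mulmxBr mulmx1 PP subrr subr0.
Qed.

Lemma proj_psd n (P : 'M[C]_n) : is_proj P -> psd P.
Proof. by case=> PP aP; rewrite -PP -{1}aP; apply: psd_gram. Qed.

Lemma id_proj n : is_proj (1%:M : 'M[C]_n).
Proof. by split; rewrite ?mulmx1 ?adj1. Qed.

(** Compressing by [P] shows that [P (1 - Q) P] is both positive and negative, hence zero.
    Conversely, [Q *m P = P] makes [Q - P] a projector. *)
Lemma lowner_projP n (P Q : 'M[C]_n) : is_proj P -> is_proj Q ->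
  lowner P Q <-> Q *m P = P.
Proof.
move=> [PP aP] pQ; have [QQ aQ] := pQ; split=> [PQ|QP].
  apply/eqP; rewrite eq_sym -subr_eq0 -{1}(mul1mx P) -mulmxBl; apply/eqP.
  have pS := proj_psd (proj_compl pQ).
  have e : adj P *m (1%:M - Q) *m P = - (adj P *m (Q - P) *m P).
    by rewrite aP !mulmxBr !mulmxBl mulmx1 !PP opprB.
  apply: psd_kernel => //; apply: form_eq0 => v; apply: le_anti.
  rewrite (psd_congr P pS) andbT e mulmxN mulNmx mxoppE oppr_le0.
  exact: psd_congr.
have PQ : P *m Q = P by rewrite -[in LHS]aP -aQ -adjM QP.
rewrite /lowner; apply: proj_psd; split; last by rewrite adjB aP aQ.
by rewrite mulmxBl !mulmxBr QQ PP QP PQ subrr subr0.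
Qed.

(** The orthogonal projector onto the column space, [A X A^*], where [X] is a generalized inverse of
    the Gram matrix [G]; of [X] only [G X G = G] is used. *)
Lemma col_projector n m (A : 'M[C]_(n, m)) :
  exists P : 'M[C]_n, [/\ is_proj P, P *m A = A & exists B, P = A *m B].
Proof.
pose G := adj A *m A; pose X := pinvmx G; pose P := A *m X *m adj A.
have PA : P *m A = A.
  apply/eqP; rewrite -subr_eq0; apply/eqP.
  have -> : P *m A - A = A *m (X *m G - 1%:M).
    by rewrite mulmxBr mulmx1 /P /G !mulmxA.
  apply: gram_eq0; rewrite adjM -mulmxA (mulmxA (adj A)) -/G.
  by rewrite mulmxBr (mulmxA G X) mulmxKpV // mulmx1 subrr mulmx0.
(* [X] is not known to be hermitian; self-adjointness of [P] comes from [adj P] being equal to the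
   self-adjoint product [P *m adj P]. *)
have PPa : P *m adj P = adj P by rewrite !adjM adjK mulmxA PA.
have aP : adj P = P by rewrite -{2}(adjK P) -PPa adjM adjK.
exists P; split=> //; first by split=> //; rewrite -{2}aP PPa aP.
by exists (X *m adj A); rewrite mulmxA.
Qed.

End Positivity.

(** * Restricting and merging basis assignments *)

Section Assignments.
Variables (W X : {fset nat}).
Implicit Types (a b : bidx W) (s t u : bidx X).

Definition merge a t : bidx X :=
  [ffun x : X => if @insub nat (fun y => y \in W) W (val x) is Some w
                 then a w else t x].

Lemma restrE s (w : W) (x : X) : val x = val w -> restr W s w = s x.
Proof. by move=> e; rewrite ffunE -e valK. Qed.

Lemma mergeE_in a t (w : W) (x : X) : val x = val w -> merge a t x = a w.
Proof. by move=> e; rewrite ffunE e valK. Qed.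

Lemma mergeE_out a t (x : X) : val x \notin W -> merge a t x = t x.
Proof. by move=> xW; rewrite ffunE insubN. Qed.

Lemma agree_outP s t :
  reflect (forall x : X, val x \notin W -> s x = t x) (agree_out W s t).
Proof.
apply: (iffP forallP) => [H x xW|H x]; first exact/eqP/(implyP (H x)).
by apply/implyP=> xW; rewrite H.
Qed.

Lemma agree_outC s t : agree_out W s t = agree_out W t s.
Proof. by apply/agree_outP/agree_outP => H x xW; rewrite H. Qed.

Lemma agree_out_trans s t u :
  agree_out W s t -> agree_out W s u = agree_out W t u.
Proof.
by move=> /agree_outP st; apply/agree_outP/agree_outP => H x xW;
  rewrite -H // st.
Qed.

Lemma agree_merge a t : agree_out W (merge a t) t.
Proof. by apply/agree_outP=> x; apply: mergeE_out. Qed.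

Hypothesis sWX : (W `<=` X)%fset.

Lemma restr_merge a t : restr W (merge a t) = a.
Proof.
apply/ffunP=> w; have wX : val w \in X := fsubsetP sWX _ (valP w).
by rewrite (@restrE _ w [` wX]%fset) // (mergeE_in _ _ (w := w)).
Qed.

Lemma merge_restr s t : agree_out W s t -> merge (restr W s) t = s.
Proof.
move=> /agree_outP st; apply/ffunP=> x; have [xW|xW] := boolP (val x \in W).
  by rewrite (mergeE_in _ _ (w := [` xW]%fset)) // (restrE _ (x := x)).
by rewrite mergeE_out // st.
Qed.

Lemma restr_agree_eq s t :
  (restr W s == restr W t) && agree_out W s t = (s == t).
Proof.
apply/andP/eqP => [[/eqP e st]|->]; last by split=> //; apply/agree_outP.
by rewrite -(merge_restr st) e merge_restr //; apply/agree_outP.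
Qed.

(** An assignment that agrees with [t] off [W] is determined by its restriction to [W], which can be
    arbitrary. *)
Lemma big_agree (M : nmodType) (f : bidx X -> M) t :
  \sum_(s | agree_out W s t) f s = \sum_a f (merge a t).
Proof.
rewrite (reindex_onto (merge^~ t) (restr W)) => [|s]; last exact: merge_restr.
by apply: eq_bigl => a; rewrite agree_merge restr_merge eqxx.
Qed.

End Assignments.

Lemma restr_id (W : {fset nat}) (s : bidx W) : restr W s = s.
Proof. by apply/ffunP=> w; rewrite (restrE s (x := w)). Qed.

Lemma restr_restr (V W X : {fset nat}) (s : bidx X) :
  (V `<=` W)%fset -> (W `<=` X)%fset -> restr V (restr W s) = restr V s.
Proof.
move=> sVW sWX; apply/ffunP=> v.
have vW : val v \in W := fsubsetP sVW _ (valP v).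
have vX : val v \in X := fsubsetP sWX _ vW.
rewrite (restrE _ (x := [` vW]%fset)) // (restrE _ (x := [` vX]%fset)) //.
by rewrite (restrE _ (x := [` vX]%fset)).
Qed.

Lemma agree_out_restr (V W X : {fset nat}) (s t : bidx X) :
  (V `<=` W)%fset -> (W `<=` X)%fset ->
  agree_out V (restr W s) (restr W t) && agree_out W s t = agree_out V s t.
Proof.
move=> sVW sWX; apply/andP/agree_outP => [[/agree_outP a /agree_outP b] x xV|H].
  have [xW|xW] := boolP (val x \in W); last exact: b.
  by have := a [` xW]%fset xV; rewrite !(restrE _ (x := x)).
split; apply/agree_outP => x xV; last first.
  by apply: H; apply: contra xV; apply: (fsubsetP sVW).
have xX : val x \in X := fsubsetP sWX _ (valP x).
by rewrite !(restrE _ (x := [` xX]%fset)) // H.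
Qed.

(** * Cylindric extension of operators, and the Choi vector *)

Section Extension.
Variable C : numClosedFieldType.
Implicit Types V W X : {fset nat}.

(* [dim] alone would be the dimension of a [vectType]. *)
Lemma sum_ord_dim X (M : nmodType) (f : 'I_(Defs.dim X) -> M) :
  \sum_i f i = \sum_(s : bidx X) f (enum_rank s).
Proof.
rewrite (reindex_onto enum_rank enum_val) => [|i _]; rewrite ?enum_valK //.
by apply: eq_bigl => s; rewrite enum_rankK eqxx.
Qed.

Lemma extE W X (A : op C W) (s t : bidx X) :
  ext W X A (enum_rank s) (enum_rank t) =
    A (enum_rank (restr W s)) (enum_rank (restr W t)) * (agree_out W s t)%:R.
Proof. by rewrite mxE /bv !enum_rankK. Qed.

Lemma op_eq X (A B : op C X) :
  (forall s t, A (enum_rank s) (enum_rank t) = B (enum_rank s) (enum_rank t)) ->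
  A = B.
Proof. by move=> H; apply/matrixP=> i j; rewrite -(enum_valK i) -(enum_valK j). Qed.

(** The identity factor leaves only the basis states that agree with [s] off [W], which turns the
    sum over [X] into one over [W]. *)
Lemma ext_mulE W X (A : op C W) m (U : 'M[C]_(Defs.dim X, m)) (s : bidx X) j :
  (W `<=` X)%fset ->
  (ext W X A *m U) (enum_rank s) j =
    \sum_a A (enum_rank (restr W s)) (enum_rank a) * U (enum_rank (merge a s)) j.
Proof.
move=> sWX; rewrite mxE sum_ord_dim.
rewrite (bigID (fun t => agree_out W t s)) /= [X in _ + X]big1 ?addr0.
  rewrite big_agree //; apply: eq_bigr => a _.
  by rewrite extE restr_merge // agree_outC agree_merge mulr1.
by move=> t /negPf ts; rewrite extE agree_outC ts mulr0 mul0r.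
Qed.

Lemma extM W X (A B : op C W) : (W `<=` X)%fset ->
  ext W X (A *m B) = ext W X A *m ext W X B.
Proof.
move=> sWX; apply: op_eq => s t; rewrite ext_mulE // extE mxE sum_ord_dim mulr_suml.
apply: eq_bigr => a _.
by rewrite extE restr_merge // (agree_out_trans _ (agree_merge a s)) mulrA.
Qed.

Lemma ext1 W X : (W `<=` X)%fset -> ext W X (1%:M : op C W) = 1%:M.
Proof.
move=> sWX; apply: op_eq => s t; rewrite extE !mxE.
by rewrite !(inj_eq enum_rank_inj) -natrM mulnb restr_agree_eq.
Qed.

Lemma extB W X (A B : op C W) : ext W X (A - B) = ext W X A - ext W X B.
Proof. by apply/matrixP=> i j; rewrite !mxE mulrBl. Qed.

Lemma ext_lin W X a (A B : op C W) :
  ext W X (a *: A + B) = a *: ext W X A + ext W X B.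
Proof. by apply/matrixP=> i j; rewrite !mxE mulrDl mulrA. Qed.

Lemma ext0 W X : ext W X (0 : op C W) = 0.
Proof. by apply/matrixP=> i j; rewrite !mxE mul0r. Qed.

Lemma ext_sum W X (I : Type) (r : seq I) (A : I -> op C W) :
  ext W X (\sum_(i <- r) A i) = \sum_(i <- r) ext W X (A i).
Proof.
apply: (big_morph (ext W X) _ (ext0 W X)) => A1 A2.
by rewrite -{1}(scale1r A1) ext_lin scale1r.
Qed.

Lemma ext_adj W X (A : op C W) : ext W X (adj A) = adj (ext W X A).
Proof.
by apply/matrixP=> i j; rewrite adjE mxE adjE mxE rmorphM /= conjC_nat agree_outC.
Qed.

Lemma ext_id W (A : op C W) : ext W W A = A.
Proof.
apply: op_eq => s t; rewrite extE !restr_id (_ : agree_out W s t) ?mulr1 //.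
by apply/agree_outP=> x /negP; case; apply: valP.
Qed.

Lemma ext_ext V W X (A : op C V) : (V `<=` W)%fset -> (W `<=` X)%fset ->
  ext W X (ext V W A) = ext V X A.
Proof.
move=> sVW sWX; apply: op_eq => s t; rewrite !extE !restr_restr //.
by rewrite -mulrA -natrM mulnb agree_out_restr.
Qed.

Lemma ext_psd W X (A : op C W) : (W `<=` X)%fset -> psd A -> psd (ext W X A).
Proof.
by move=> sWX /psd_factor[B ->]; rewrite extM // ext_adj; apply: psd_gram.
Qed.

Lemma ext_proj W X (P : op C W) :
  (W `<=` X)%fset -> is_proj P -> is_proj (ext W X P).
Proof. by move=> sWX [PP aP]; split; rewrite -?extM -?ext_adj ?PP ?aP. Qed.

(* The witness is the unnormalized maximally entangled vector between [V] and a
   disjoint shifted copy of [V]: the coordinates of [(K (x) I) Omega] are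
   exactly the matrix entries of [K] (Choi-Jamiolkowski). *)
Lemma choi_vector V :
  exists (W : {fset nat}) (Omega : vec C W)
    (idx : 'I_(Defs.dim V) -> 'I_(Defs.dim V) -> 'I_(Defs.dim W)),
    (V `<=` W)%fset /\
    forall (K : op C V) i j, (ext V W K *m Omega) (idx i j) 0 = K i j.
Proof.
(* [N] exceeds every variable of [V], so shifting by [N] leaves [V]. *)
pose N := (\max_(v : V) val v).+1.
have shift_notin (v : V) : (val v + N)%N \notin V.
  apply/negP => vN; have := @leq_bigmax _ (fun v : V => val v) [` vN]%fset.
  by rewrite /= leqNgt /N addnS ltnS leq_addl.
pose W := (V `|` [fset (v + N)%N | v in V])%fset.
have sVW : (V `<=` W)%fset by apply: fsubsetUl.
have shift_in (v : V) : (val v + N)%N \in W.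
  rewrite in_fsetU; apply/orP; right; apply/imfsetP.
  by exists (val v) => //; apply: valP.
pose copy (s : bidx W) : bidx V := [ffun v => s [` shift_in v]%fset].
pose Omega : vec C W := \col_i (restr V (bv i) == copy (bv i))%:R.
(* Only the values on the shifted copy matter. On [V] the subtraction truncates to 0, but [merge]
   overwrites the values there. *)
pose paste (b : bidx V) : bidx W :=
  [ffun x => if @insub nat (fun y => y \in V) V (val x - N)%N is Some v
             then b v else false].
have pasteK b : copy (paste b) = b.
  by apply/ffunP=> v; rewrite ffunE ffunE /= addnK valK.
have copy_merge (a : bidx V) s : copy (merge a s) = copy s.
  by apply/ffunP=> v; rewrite ffunE mergeE_out ?shift_notin // ffunE.
exists W, Omega, (fun i j => enum_rank (merge (enum_val i) (paste (enum_val j)))).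
(* In row [idx i j], the entry of [Omega] is nonzero only for the summand whose [V]-part equals the
   content [enum_val j] of the copy. *)
split=> // K i j; rewrite ext_mulE // (bigD1 (enum_val j)) //= restr_merge //.
rewrite mxE /bv enum_rankK restr_merge // !copy_merge pasteK eqxx mulr1 !enum_valK.
rewrite big1 ?addr0 // => a aj.
by rewrite mxE /bv enum_rankK restr_merge // !copy_merge pasteK (negPf aj) mulr0.
Qed.

End Extension.

(** * Kernel criteria for positive operators and projectors *)

Section Triples.
Variable C : numClosedFieldType.

Lemma psd_anti n (A : 'M[C]_n) : psd A -> psd (- A) -> A = 0.
Proof.
move=> pA nA; apply: form_eq0 => v; apply: le_anti.
by rewrite pA andbT -oppr_ge0 -mxoppE -mulNmx -mulmxN.
Qed.

(** If the sum kills [U], then the compression of [A] by [U] is the negative of that of [B], so it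
    is positive and negative at once. *)
Lemma psdD_kernel n m (A B : 'M[C]_n) (U : 'M[C]_(n, m)) : psd A -> psd B ->
  (A + B) *m U = 0 <-> A *m U = 0 /\ B *m U = 0.
Proof.
move=> pA pB; split=> [AB0|[A0 B0]]; last by rewrite mulmxDl A0 B0 addr0.
have AU : A *m U = 0.
  apply: psd_kernel => //; apply: psd_anti; first exact: psd_congr.
  suff -> : - (adj U *m A *m U) = adj U *m B *m U by apply: psd_congr.
  apply/eqP; rewrite -subr_eq0 -opprD oppr_eq0.
  by rewrite -mulmxDl -mulmxDr -mulmxA AB0 mulmx0.
by split=> //; move: AB0; rewrite mulmxDl AU add0r.
Qed.

(** Compressing by [P] leaves [- P Z P], which forces [P Z P = 0]. Conversely, once [Z P = 0], the
    operator is the compression of [1 - Z] by [1 - P]. *)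
Lemma psd_compl_proj n (P Z : 'M[C]_n) : is_proj P -> psd Z -> psd (1%:M - Z) ->
  psd (1%:M - P - Z) <-> Z *m P = 0.
Proof.
move=> pP pZ pcZ; have [PP aP] := pP; split=> [H|ZP].
  apply: psd_kernel => //; apply: psd_anti; first exact: psd_congr.
  have := psd_congr P H; rewrite mulmxBr mulmxBl aP mulmxBr mulmx1 PP subrr.
  by rewrite mul0mx sub0r.
have PZ : P *m Z = 0 by rewrite -aP -(psd_herm pZ) -adjM ZP adj0.
have [_ acP] := proj_compl pP.
suff -> : 1%:M - P - Z = adj (1%:M - P) *m (1%:M - Z) *m (1%:M - P).
  exact: psd_congr.
rewrite acP !(mulmxBl, mulmxBr) !(mul1mx, mulmx1) -(mulmxA P) ZP PZ PP mulmx0.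
by rewrite !subr0 subrr subr0 addrAC.
Qed.

(** * Kraus maps in the Heisenberg picture *)

Section Kraus.
Variables (n : nat) (Ks : seq 'M[C]_n).

Definition kraus_map (rho : 'M[C]_n) := \sum_(K <- Ks) K *m rho *m adj K.
Definition kraus_dual (M : 'M[C]_n) := \sum_(K <- Ks) adj K *m M *m K.

Lemma tr_kraus_dual M rho : \tr (M *m kraus_map rho) = \tr (kraus_dual M *m rho).
Proof.
rewrite /kraus_map /kraus_dual mulmx_sumr mulmx_suml !raddf_sum.
by apply: eq_bigr => K _ /=; rewrite -!mulmxA [RHS]mxtrace_mulC !mulmxA.
Qed.

Lemma kraus_dualB M N : kraus_dual (M - N) = kraus_dual M - kraus_dual N.
Proof.
by rewrite -sumrB; apply: eq_bigr => K _; rewrite mulmxBr mulmxBl.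
Qed.

Lemma kraus_dual_psd M : psd M -> psd (kraus_dual M).
Proof. by move=> pM; apply: psd_sum => K _; apply: psd_congr. Qed.

(** A sum of positive terms kills [U] only if each term does, and each term is the Gram matrix of
    [Q *m K]. *)
Lemma kraus_dual_kernel m (Q : 'M[C]_n) (U : 'M[C]_(n, m)) : is_proj Q ->
  kraus_dual Q *m U = 0 <-> {in Ks, forall K, Q *m K *m U = 0}.
Proof.
move=> pQ; have [QQ aQ] := pQ; split=> [H K KKs|H]; last first.
  rewrite mulmx_suml big1_seq // => K /= KKs.
  by rewrite -!mulmxA (mulmxA Q) H // mulmx0.
move: H; rewrite /kraus_dual (big_rem K) //= => /psdD_kernel[].
- exact/psd_congr/proj_psd.
- by apply: psd_sum => L _; apply/psd_congr/proj_psd.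
move=> H _; apply: gram_eq0.
rewrite !adjM aQ !mulmxA -(mulmxA _ Q Q) QQ -!mulmxA (mulmxA _ Q) (mulmxA _ K).
by rewrite H mulmx0.
Qed.

Variables P Q : 'M[C]_n.
Hypotheses (pP : is_proj P) (pQ : is_proj Q).
Let S := 1%:M - kraus_dual 1%:M.
Hypothesis pS : psd S.

Lemma par_kernelP :
  (forall rho, pdo rho ->
     \tr (P *m rho) <= \tr (Q *m kraus_map rho) + \tr rho - \tr (kraus_map rho))
  <-> {in Ks, forall K, (1%:M - Q) *m K *m P = 0}.
Proof.
have pcQ := proj_compl pQ.
have pH := kraus_dual_psd (proj_psd pcQ).
(* This operator is [S] plus the dual of [Q], so its positivity rests on that of the defect. *)
have pcH : psd (1%:M - kraus_dual (1%:M - Q)).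
  rewrite kraus_dualB opprB addrCA addrC.
  by apply: psdD => //; apply/kraus_dual_psd/proj_psd.
rewrite -(kraus_dual_kernel _ pcQ) -(psd_compl_proj pP pH pcH) psdP.
have e rho : \tr ((1%:M - P - kraus_dual (1%:M - Q)) *m rho) =
    \tr (Q *m kraus_map rho) + \tr rho - \tr (kraus_map rho) - \tr (P *m rho).
  rewrite -{2}(mul1mx (kraus_map rho)) !tr_kraus_dual kraus_dualB !mulmxBl.
  by rewrite !raddfB /= mul1mx opprK addrACA addrA addrC !addrA.
by split=> H rho /H; rewrite e subr_ge0.
Qed.

Lemma tot_kernelP :
  (forall rho, pdo rho -> \tr (P *m rho) <= \tr (Q *m kraus_map rho))
  <-> S *m P = 0 /\ {in Ks, forall K, (1%:M - Q) *m K *m P = 0}.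
Proof.
have pcQ := proj_compl pQ; have pH := kraus_dual_psd (proj_psd pcQ).
(* Adding [S] absorbs the lost trace: the complement is exactly the dual of [Q]. *)
have eQ : 1%:M - (S + kraus_dual (1%:M - Q)) = kraus_dual Q.
  by rewrite /S kraus_dualB addrA subrK opprB addrC subrK.
have pcH : psd (1%:M - (S + kraus_dual (1%:M - Q))).
  by rewrite eQ; apply/kraus_dual_psd/proj_psd.
rewrite -(kraus_dual_kernel _ pcQ) -(psdD_kernel _ pS pH).
rewrite -(psd_compl_proj pP (psdD pS pH) pcH) psdP.
have e rho : \tr ((1%:M - P - (S + kraus_dual (1%:M - Q))) *m rho) =
    \tr (Q *m kraus_map rho) - \tr (P *m rho).
  by rewrite addrAC eQ mulmxBl raddfB /= tr_kraus_dual.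
by split=> H rho /H; rewrite e subr_ge0.
Qed.

End Kraus.

(** * Trace defect, termination space and correctness of programs *)

Section Programs.
Variable V : {fset nat}.
Implicit Types (E F : superop C V) (T : op C V) (W X : {fset nat}).

Definition defect E : op C V := 1%:M - kraus_dual E 1%:M.

Lemma tr_defect E rho : \tr (defect E *m rho) = \tr rho - \tr (so_apply E rho).
Proof.
by rewrite mulmxBl raddfB /= mul1mx -tr_kraus_dual mul1mx.
Qed.

Lemma defect_psd E : DProg E -> psd (defect E).
Proof. by move=> dE; apply/psdP => rho prho; rewrite tr_defect subr_ge0 dE. Qed.

Lemma trace_preserving_defect E : trace_preserving E -> defect E = 0.
Proof.
by move=> tE; apply: form_eq0 => v; rewrite -tr_outer tr_defect tE subrr.
Qed.

(** Losing no trace at [psi] means that the form of the defect vanishes there; for a positive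
    operator this is membership in the kernel. *)
Lemma in_termP E (psi : vec C V) : DProg E ->
  in_term E psi <-> defect E *m psi = 0.
Proof.
move=> dE; have pS := defect_psd dE; split=> [/eqP|H].
  rewrite /in_term eq_sym -subr_eq0 -tr_defect tr_outer => /eqP H.
  by apply: psd_kernel => //; apply/matrixP=> i j; rewrite !ord1 H mxE.
by apply/eqP; rewrite eq_sym -subr_eq0 -tr_defect mulmxA H mul0mx mxtrace0.
Qed.

Lemma term_proj_defect E T m (M : 'M[C]_(Defs.dim V, m)) :
  DProg E -> term_proj E T -> T *m M = M <-> defect E *m M = 0.
Proof.
move=> dE [_ tT].
have colM (A : op C V) (N : 'M[C]_(Defs.dim V, m)) :
  A *m M = N <-> forall j, A *m col j M = col j N.
  split=> [<- j|H]; first by rewrite !colE mulmxA.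
  apply/matrixP=> i j; have /matrixP/(_ i 0) := H j.
  by rewrite colE mulmxA -colE !mxE.
rewrite !colM; split=> H j; have := H j.
  by move=> /tT/in_termP->//; apply/matrixP=> i k; rewrite !mxE.
by move=> e; apply/tT/in_termP => //; rewrite e; apply/matrixP=> i k; rewrite !mxE.
Qed.

Lemma ext_defect E X : (V `<=` X)%fset ->
  ext V X (defect E) = 1%:M - kraus_dual [seq ext V X K | K <- E] 1%:M.
Proof.
move=> sVX; rewrite extB ext1 // ext_sum /kraus_dual big_map.
by congr (_ - _); apply: eq_bigr => K _; rewrite !mulmx1 extM // ext_adj.
Qed.

(** Vectors on [X] need not be products, so the kernel description on [V] is first turned into two
    operator identities, [defect E *m T = 0] and [1 - T = B *m defect E]. Both survive extension. *)
Lemma ext_term_proj E T X m (M : 'M[C]_(Defs.dim X, m)) : DProg E -> term_proj E T ->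
  (V `<=` X)%fset -> ext V X T *m M = M <-> ext V X (defect E) *m M = 0.
Proof.
move=> dE tT sVX; have ST : defect E *m T = 0.
  by apply/(term_proj_defect _ dE tT); case: tT => [[]].
(* Row-space inclusion is tested on the cokernel matrix: the defect kills its columns, so [T] fixes
   them. *)
have /submxP[B TB] : (1%:M - T <= defect E)%MS.
  rewrite submxE mulmxBl mul1mx; apply/eqP/eqP.
  by rewrite subr_eq0 eq_sym; apply/eqP/(term_proj_defect _ dE tT)/mulmx_coker.
split=> [<-|H]; first by rewrite mulmxA -extM // ST ext0 mul0mx.
apply/eqP; rewrite eq_sym -subr_eq0 -{1}(mul1mx M) -mulmxBl -(ext1 C sVX) -extB TB.
by rewrite extM // -mulmxA H mulmx0.
Qed.

(** Each equation says that [K] maps the range of [P] into the range of [Q], in a form linear in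
    [K]. *)
Definition kills E W (P Q : op C W) X :=
  {in E, forall K, (1%:M - ext W X Q) *m ext V X K *m ext W X P = 0}.

Lemma killsP E W (P Q : op C W) X :
  {in [seq ext V X K | K <- E], forall L, (1%:M - ext W X Q) *m L *m ext W X P = 0}
  <-> kills E P Q X.
Proof.
by split=> [H K KE|H _ /mapP[K KE ->]]; [apply: H; apply: map_f | apply: H].
Qed.

Lemma so_extE E X (rho : op C X) :
  so_ext X E rho = kraus_map [seq ext V X K | K <- E] rho.
Proof. by rewrite /kraus_map big_map. Qed.

Lemma models_parP E W (P Q : op C W) : DProg E -> is_proj P -> is_proj Q ->
  models_par E P Q <-> forall X, (V `|` W `<=` X)%fset -> kills E P Q X.
Proof.
move=> dE pP pQ.
suff H X : (V `|` W `<=` X)%fset ->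
  (forall rho : op C X, pdo rho ->
    \tr (ext W X P *m rho) <=
      \tr (ext W X Q *m so_ext X E rho) + \tr rho - \tr (so_ext X E rho))
  <-> kills E P Q X by split=> H0 X sX; apply/(H X sX)/H0.
rewrite fsubUset => /andP[sVX sWX].
have := @par_kernelP _ [seq ext V X K | K <- E] _ _ (ext_proj sWX pP) (ext_proj sWX pQ).
rewrite -ext_defect // killsP => /(_ (ext_psd sVX (defect_psd dE))) <-.
by split=> H rho /H; rewrite so_extE.
Qed.

Lemma models_totP E W (P Q : op C W) : DProg E -> is_proj P -> is_proj Q ->
  models_tot E P Q <-> forall X, (V `|` W `<=` X)%fset ->
    ext V X (defect E) *m ext W X P = 0 /\ kills E P Q X.
Proof.
move=> dE pP pQ.
suff H X : (V `|` W `<=` X)%fset ->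
  (forall rho : op C X, pdo rho ->
    \tr (ext W X P *m rho) <= \tr (ext W X Q *m so_ext X E rho))
  <-> ext V X (defect E) *m ext W X P = 0 /\ kills E P Q X
  by split=> H0 X sX; apply/(H X sX)/H0.
rewrite fsubUset => /andP[sVX sWX].
have := @tot_kernelP _ [seq ext V X K | K <- E] _ _ (ext_proj sWX pP) (ext_proj sWX pQ).
rewrite -ext_defect // killsP => /(_ (ext_psd sVX (defect_psd dE))) <-.
by split=> H rho /H; rewrite so_extE.
Qed.

(** Linearity is a plain equation, so that [f] can be a bare function of the Kraus operator. *)
Lemma span_eq0 (U U' : vectType C) (f : U -> U') (s : seq U) :
  (forall a u v, f (a *: u + v) = a *: f u + f v) ->
  {in s, forall u, f u = 0} -> {in <<s>>%VS, forall u, f u = 0}.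
Proof.
move=> fL f0 u; rewrite -[s]/(tval (in_tuple s)) => /coord_span->.
have f00 : f 0 = 0 by have := fL (-1) 0 0; rewrite scaler0 add0r scaleN1r addNr.
apply: (big_ind (fun v => f v = 0)) => // [v w v0 w0|i _].
  by have := fL 1 v w; rewrite !scale1r v0 w0 addr0.
have := fL (coord (in_tuple s) i u) s`_i 0; rewrite !addr0 f00 addr0 => ->.
by rewrite f0 ?scaler0 //; apply: mem_nth.
Qed.

Lemma so_comp_proj E T : so_comp E (so_proj T) = [seq K *m T | K <- E].
Proof. by rewrite /so_comp; elim: E => //= K E ->. Qed.

(** Since [T] fixes the range of [P], each [K] may be replaced by [K *m T]; the condition, linear in
    [K], then passes to the whole span. *)
Lemma kills_span E F T W (P Q : op C W) X :
  (so_span (so_comp F (so_proj T)) <= so_span (so_comp E (so_proj T)))%VS ->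
  (V `<=` X)%fset -> ext V X T *m ext W X P = ext W X P ->
  kills E P Q X -> kills F P Q X.
Proof.
rewrite !so_comp_proj => /subvP sFE sVX TP kE K KF.
have e L : (1%:M - ext W X Q) *m ext V X L *m ext W X P =
   (1%:M - ext W X Q) *m ext V X (L *m T) *m ext W X P.
  by rewrite extM // -!mulmxA TP.
rewrite e; apply: (@span_eq0 _ _
  (fun L : op C V => (1%:M - ext W X Q) *m ext V X L *m ext W X P)
  [seq K *m T | K <- E]).
- by move=> a A B; rewrite ext_lin mulmxDr mulmxDl -scalemxAr -scalemxAl.
- by move=> _ /mapP[L LE ->]; rewrite -e kE.
- by apply: sFE; apply: memv_span; apply: map_f.
Qed.

(* [P] projects onto the Choi vector of [T], and [Q] onto the span of the Choi
   vectors of the [K T], [K] in [E]. *)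
Lemma choi_test E T : exists W (P Q : op C W),
  [/\ (V `<=` W)%fset, is_proj P /\ is_proj Q,
      exists B, P = ext V W T *m B,
      {in E, forall K, (1%:M - Q) *m ext V W K *m P = 0}
    & forall K, (1%:M - Q) *m ext V W K *m P = 0 ->
        K *m T \in so_span (so_comp E (so_proj T))].
Proof.
have [W [Omega [idx [sVW OmegaE]]]] := choi_vector C V.
pose w := ext V W T *m Omega.
pose A : 'M[C]_(Defs.dim W, size E) := \matrix_(i, j) (ext V W E`_j *m w) i 0.
have [P [pP Pw [B PB]]] := col_projector w.
have [Q [pQ QA [D QD]]] := col_projector A.
exists W, P, Q; split=> //.
- by exists (Omega *m B); rewrite mulmxA.
- move=> K KE; rewrite PB mulmxA -(mulmxA _ _ w).
  have -> : ext V W K *m w = A *m delta_mx (Ordinal (etrans (index_mem K E) KE)) 0.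
    by rewrite -colE; apply/matrixP=> i j; rewrite [RHS]mxE [RHS]mxE ord1 /= nth_index.
  by rewrite (mulmxA _ A) mulmxBl mul1mx QA subrr !mul0mx.
(* [Q] fixes the Choi vector of [K *m T], and [Q = A *m D], so this vector is a combination of the
   columns of [A] with coefficients [c]. *)
move=> K /(congr1 (mulmx^~ w)); rewrite mul0mx -mulmxA Pw -mulmxA mulmxBl mul1mx.
move=> /eqP; rewrite subr_eq0 => /eqP; rewrite QD -mulmxA.
set c := D *m _ => KwE.
have -> : K *m T = \sum_(k < size E) c k 0 *: (E`_k *m T).
  (* Matrix entries are Choi coordinates, so the combination found for vectors holds for
     operators. *)
  apply/matrixP=> i j; rewrite -OmegaE extM // -mulmxA -/w KwE.
  rewrite -[RHS]OmegaE ext_sum mulmx_suml summxE mxE; apply: eq_bigr => k _.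
  have -> : ext V W (c k 0 *: (E`_k *m T)) = c k 0 *: ext V W (E`_k *m T).
    by rewrite -[_ *: (_ *m _)]addr0 ext_lin ext0 addr0.
  by rewrite mxE -scalemxAl mxscaleE extM // -mulmxA mulrC.
rewrite so_comp_proj; apply: memv_suml => k _; apply/memvZ/memv_span.
by apply: map_f; apply: mem_nth.
Qed.

(** Extension from [W] to [X] is multiplicative, so the Choi test has to be checked on [W] only. *)
Lemma kills_ext E W (P Q : op C W) X : (V `<=` W)%fset -> (W `<=` X)%fset ->
  {in E, forall K, (1%:M - Q) *m ext V W K *m P = 0} -> kills E P Q X.
Proof.
move=> sVW sWX H K KE; rewrite -(ext1 C sWX) -extB -(ext_ext _ sVW sWX) -!extM //.
by rewrite H // ext0.
Qed.

Lemma kills_self E W (P Q : op C W) :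
  kills E P Q W -> {in E, forall K, (1%:M - Q) *m ext V W K *m P = 0}.
Proof. by move=> H K /H; rewrite !ext_id. Qed.

Lemma so_comp1 E : so_comp E (so_proj 1%:M) = E.
Proof.
by rewrite so_comp_proj -[RHS]map_id; apply: eq_map => K; rewrite mulmx1.
Qed.

(** * Refinement as inclusion of spans *)

Lemma le_P_span E F : DProg E -> DProg F ->
  le_P E F <-> (so_span F <= so_span E)%VS.
Proof.
move=> dE dF; split=> [EF|].
  have [W [P [Q [sVW [pP pQ] _ kE inE]]]] := choi_test E 1%:M.
  have /EF : models_par E P Q.
    apply/models_parP => // X; rewrite fsubUset => /andP[_ sWX].
    exact: kills_ext.
  move=> /(_ pP pQ) /models_parP-/(_ dF pP pQ W).
  rewrite fsubUset sVW fsubset_refl => /(_ isT)/kills_self kF.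
  apply/span_subvP => K KF; rewrite -(so_comp1 E) -(mulmx1 K).
  exact/inE/kF.
rewrite -{1}(so_comp1 F) -{1}(so_comp1 E) => sFE W P Q pP pQ.
move=> /models_parP-/(_ dE pP pQ) kE.
apply/models_parP => // X sX; apply: (kills_span sFE _ _ (kE X sX));
  by move: sX; rewrite fsubUset => /andP[sVX _]; rewrite ?ext1 ?mul1mx.
Qed.

Lemma le_T_span E F TE TF : DProg E -> DProg F -> term_proj E TE -> term_proj F TF ->
  le_T E F <-> lowner TE TF /\
    (so_span (so_comp F (so_proj TE)) <= so_span (so_comp E (so_proj TE)))%VS.
Proof.
move=> dE dF tE tF; have [[pTE _] [pTF _]] := (tE, tF).
have SE : defect E *m TE = 0.
  by apply/(term_proj_defect _ dE tE); case: pTE.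
rewrite lowner_projP //; split=> [EF|[TT sFE] W P Q pP pQ].
  split.
    apply/(term_proj_defect _ dF tF).
    (* With the trivial postcondition, total correctness is termination alone; its transfer to [F]
       gives the inclusion of termination spaces. *)
    have /EF : models_tot E TE 1%:M.
      apply/models_totP => //; first exact: id_proj.
      move=> X; rewrite fsetUid => sVX; split; first by rewrite -extM // SE ext0.
      by move=> K KE; rewrite ext1 // subrr !mul0mx.
    move=> /(_ pTE (id_proj _ _)) /models_totP-/(_ dF pTE (id_proj _ _) V).
    by rewrite fsetUid fsubset_refl !ext_id => /(_ isT)[].
  have [W [P [Q [sVW [pP pQ] [B PB] kE inE]]]] := choi_test E TE.
  have /EF : models_tot E P Q.
    apply/models_totP => // X; rewrite fsubUset => /andP[sVX sWX].
    split; last exact: kills_ext.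
    (* [P] factors through the extension of [TE], which the defect annihilates. *)
    by rewrite -(ext_ext _ sVW sWX) -extM // PB mulmxA -extM // SE ext0 mul0mx ext0.
  move=> /(_ pP pQ) /models_totP-/(_ dF pP pQ W).
  rewrite fsubUset sVW fsubset_refl => /(_ isT)[_ /kills_self kF].
  rewrite {1}so_comp_proj; apply/span_subvP => _ /mapP[K KF ->].
  exact/inE/kF.
move=> /models_totP-/(_ dE pP pQ) kE.
apply/models_totP => // X sX; have [S0 kX] := kE X sX.
have sVX : (V `<=` X)%fset by move: sX; rewrite fsubUset => /andP[].
(* Termination of [E] on [P] says that [TE] fixes the range of [P]. This allows the replacement of
   [K] by [K *m TE], and with [TT] it yields termination of [F]. *)
have /(ext_term_proj _ dE tE sVX) TP := S0.
split; last exact: (kills_span sFE).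
by apply/(ext_term_proj _ dF tF sVX); rewrite -TP mulmxA -extM // TT.
Qed.

(** The defects vanish, so the total and partial kernel conditions coincide for each of the two
    programs. *)
Lemma le_T_P E F : DProg E -> DProg F -> trace_preserving E -> trace_preserving F ->
  le_T E F <-> le_P E F.
Proof.
move=> dE dF tE tF.
have tot_par (G : superop C V) W (P Q : op C W) : DProg G -> trace_preserving G ->
    is_proj P -> is_proj Q -> models_tot G P Q <-> models_par G P Q.
  move=> dG tG pP pQ; have S0 := trace_preserving_defect tG.
  rewrite models_totP // models_parP //.
  by split=> H X /H => [[]|]; rewrite ?S0 ?ext0 ?mul0mx.
by split=> H W P Q pP pQ /(tot_par _ _ _ _ dE tE pP pQ)/(H _ _ _ pP pQ)
  /(tot_par _ _ _ _ dF tF pP pQ).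
Qed.

End Programs.
End Triples.

Theorem theorem4p7 (R : realType) (V : {fset nat}) (E F : superop R[i] V) :
  DProg E -> DProg F ->
  (le_P E F <-> (so_span F <= so_span E)%VS) /\
  (forall TE TF : op R[i] V, term_proj E TE -> term_proj F TF ->
     (le_T E F <->
        lowner TE TF /\
        (so_span (so_comp F (so_proj TE)) <= so_span (so_comp E (so_proj TE)))%VS)) /\
  (trace_preserving E -> trace_preserving F -> (le_T E F <-> le_P E F)).
Proof.
move=> dE dF; split; first exact: le_P_span.
by split=> [TE TF|]; [apply: le_T_span | apply: le_T_P].
Qed.
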